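(* Let $(X,d)$ be a metric space and $g:X\to\mathbb{R}$ a function bounded above. Let $t:X\to(0,\infty)$, $\delta:X\to(0,\infty)$, $\xi:X\to(0,\infty)$ and $e:X\times X\to(0,\infty)$ be functions for which there are constants $\overline{t},\overline{\delta},\underline{\xi},\underline{e}>0$ with, for all $x,y\in X$, $$0<t(y)\le\overline{t},\qquad \delta(x)\le\overline{\delta},\qquad \xi(x)\ge\underline{\xi},\qquad e(x,y)\ge\underline{e}.$$ Put $A(x,y)=t(y)\,\delta(x)\,(g(y)-g(x))$, $C(x,y)=e(x,y)\,d(x,y)$, $\theta(x,y)=\dfrac{\xi(x)e(x,y)}{t(y)\delta(x)}$, $\theta=\dfrac{\underline{\xi}\,\underline{e}}{\overline{t}\,\overline{\delta}}>0$, and $$W(x)=\{y\in X:\ A(x,y)\ge\xi(x)C(x,y)\},\qquad S(x)=\{y\in X:\ g(y)-g(x)\ge\theta\,d(x,y)\}.$$ Then $\theta(x,y)\ge\theta$ for all $x,y\in X$, and the following hold. (a) $W(x)\subset S(x)$ for all $x\in X$, and the enclosing process is nested: $y\in S(x)$ implies $S(y)\subset S(x)$. (b) Suppose $(X,d)$ is complete. Then for every $x_0\in X$, every sequence $(x_n)_{n\in\mathbb{N}}$ with $x_{n+1}\in W(x_n)$ (hence $x_{n+1}\in S(x_n)$) for all $n$ converges to some $x^{\ast}\in X$. It converges in finite time, i.e. $$\sum_{n=0}^{\infty}\bigl(h(x_n)+t(x_n,x_{n+1})\bigr)<+\infty,$$ if, along the process, the total time spent for exploitation $\sum_{n=0}^{\infty}t(x_n)$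 is finite and the speed of moving is greater than or equal to some constant $v>0$, i.e. $d(x_n,x_{n+1})\ge v\,t(x_n,x_{n+1})$ for all $n$. (c) Suppose $(X,d)$ is complete and let $(x_n)_{n\in\mathbb{N}}$ satisfy $x_{n+1}\in W(x_n)$ for all $n$ and ''improve enough'': for some $\underline{\sigma}\in(0,1)$, $$g(x_{n+1})-g(x_n)\ge\underline{\sigma}\,\bigl(s(x_n)-g(x_n)\bigr)\quad\text{for all } n,\qquad s(x)=\sup\{g(y):y\in S(x)\}.$$ Then $(x_n)$ converges to some $x^{\ast}\in X$ and $\rho(S(x_n))\to 0$ as $n\to+\infty$. If moreover $g$ is upper semicontinuous, then the limit $x^{\ast}$ satisfies $S(x^{\ast})=\{x^{\ast}\}$, hence $W(x^{\ast})=\{x^{\ast}\}$ (that is, $x^{\ast}$ is a behavioral rest point), and $\widehat{g}(x^{\ast})=g(x^{\ast})$ (no residual frustration).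
   Context: Notation. $g$ is the instantaneous (per unit of time) utility; $t(y)$ is the time of exploitation at state $y$; $\delta(x)>0$ is the character index (sum of psychological weights); $\xi(x)$ is the non-sacrificing rate; $e(x,y)$ is the cost (effort) of moving per unit of distance; $A(x,y)$ and $C(x,y)$ are the advantages and costs to move from $x$ to $y$. Times. $t(x,y)\ge 0$ (a function of two states, distinct from $t(y)$) is the time spent moving from $x$ to $y$, with $t(x,x)=0$, and the speed of moving is $v(x,y)=d(x,y)/t(x,y)$. An exploration-exploitation phase at $x$ has duration $h(x)\ge 0$, of which a fraction $\alpha(x)\in[0,1]$ is spent exploiting and the rest exploring, so that $t(x)=\alpha(x)h(x)$. The process alternates exploration-exploitation phases at $x_n$ and moving phases from $x_n$ to $x_{n+1}$, so its total duration is $\sum_{n}(h(x_n)+t(x_n,x_{n+1}))$. The radius of $S(x)$ is $\rho(S(x))=\sup_{y\in S(x)}d(x,y)$. The aspiration level at $x$ is $\widehat{g}(x)=g(x)+p(x)\,(s(x)-g(x))$, where $p:X\to(0,\infty)$ and $s(x)=\sup\{g(y):y\in S(x)\}$.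
   Formalization: In (b), the finite-time claim is proved under the added assumption that the exploitation fraction α(x_n) is bounded below by some constant a>0 along the process; without it the claim is false, since Σh(x_n) may diverge although Σt(x_n) is finite. *)

(* Defs.v *)
From mathcomp Require Import all_boot all_order all_algebra.
From mathcomp Require Import all_classical all_reals all_analysis.

Set Implicit Arguments.
Unset Strict Implicit.
Unset Printing Implicit Defensive.

Import Order.TTheory GRing.Theory Num.Theory.
Import numFieldNormedType.Exports.

Local Open Scope classical_set_scope.
Local Open Scope ring_scope.

(* [completeType] would force the space to be pointed, and completeness is only
   assumed in part of the result; this is the axiom of that structure. *)
Definition complete_space (X : uniformType) : Prop :=
  forall F : set_system X, ProperFilter F -> cauchy F -> exists x : X, F --> x.

Definition upper_semicontinuous (R : realType) (X : topologicalType)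
    (g : X -> R) : Prop :=
  lower_semicontinuous (fun x => (- g x)%:E).

Section WorthwhileMoves.
Variables (R : realType) (X : metricType R).
Variables (g t delta xi : X -> R) (e : X -> X -> R).

Definition advantage (x y : X) : R := t y * delta x * (g y - g x).

Definition moving_cost (x y : X) : R := e x y * mdist x y.

Definition theta_rate (x y : X) : R := (xi x * e x y) / (t y * delta x).

Definition worthwhile (x : X) : set X :=
  [set y | advantage x y >= xi x * moving_cost x y].

End WorthwhileMoves.

Section EnclosingProcess.
Variables (R : realType) (X : metricType R) (theta : R) (g : X -> R).

Definition enclosing (x : X) : set X :=
  [set y | g y - g x >= theta * mdist x y].

(* A real supremum: the set contains g x when 0 <= theta, and it is bounded
   above when g is. *)
Definition best_utility (x : X) : R := sup [set g y | y in enclosing x].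

Definition aspiration (p : X -> R) (x : X) : R :=
  g x + p x * (best_utility x - g x).

(* Extended-real valued, so that an unbounded set has radius +oo, whereas the
   real-valued [sup] would give it radius 0. *)
Definition enclosing_radius (x : X) : \bar R :=
  ereal_sup [set (mdist x y)%:E | y in enclosing x].

End EnclosingProcess.

(* Main.v *)
Require Import Defs.
From mathcomp Require Import all_boot all_order all_algebra.
From mathcomp Require Import all_classical all_reals all_analysis.
From mathcomp Require Import lra.

Set Implicit Arguments.
Unset Strict Implicit.
Unset Printing Implicit Defensive.

Import Order.TTheory GRing.Theory Num.Theory.
Import numFieldNormedType.Exports.

Local Open Scope classical_set_scope.
Local Open Scope ring_scope.


(** A worthwhile move satisfies g y - g x >= theta(x,y) d(x,y), and the bounds
    on the parameters give theta(x,y) >= theta, so each move pays for its length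
    at the uniform rate theta. The relation y \in S(x) is therefore a preorder,
    the Ekeland order of g: it is transitive by the triangle inequality
    ([enclosing_trans]), and g increases along it. Since g is bounded above, its
    values along a process converge. The distance between two terms of the
    process is at most the gain in g between them divided by theta, so the
    process is Cauchy ([process_cauchy]) and of finite length
    ([process_length_lty]). A finite length and a positive lower bound on the
    speed bound the total moving time; the exploitation times and a positive
    lower bound on alpha bound the total duration of the other phases.

    If each step achieves a fixed fraction sigma of the best possible gain
    s(x) - g(x), this best gain tends to 0 along the process; as theta times the
    radius of S(x) is at most s(x) - g(x), the radii tend to 0
    ([enclosing_radius_cvg0]). Upper semicontinuity of g makes every S(x) closed
    ([closed_enclosing]), so the limit of the process lies in all the nested sets
    S(u_n), and so does everything reachable from it. As the radii of these sets
    vanish, nothing but the limit itself is reachable ([enclosing_limit]). *)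

Section Worthwhile.
Variables (R : realType) (X : metricType R).
Variables (g t delta xi : X -> R) (e : X -> X -> R).
Hypothesis t_gt0 : forall y, 0 < t y.
Hypothesis delta_gt0 : forall x, 0 < delta x.

Local Notation W := (worthwhile g t delta xi e).

(** Dividing A(x,y) >= xi(x) C(x,y) by t(y) delta(x) puts the worthwhile
    condition in the form that defines S, with theta(x,y) in place of theta. *)
Lemma worthwhileE x y :
  W x y = (theta_rate t delta xi e x y * mdist x y <= g y - g x) :> Prop.
Proof.
rewrite /worthwhile /= /advantage /moving_cost /theta_rate.
by rewrite [in RHS]mulrAC ler_pdivrMr ?mulr_gt0// mulrA [_ * (t y * _)]mulrC.
Qed.

Lemma worthwhile_refl x : W x x.
Proof. by rewrite worthwhileE mdistxx mulr0 subrr. Qed.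

Lemma worthwhile_sub_enclosing theta x :
  (forall y, theta <= theta_rate t delta xi e x y) ->
  W x `<=` enclosing theta g x.
Proof.
move=> theta_le y; rewrite worthwhileE /enclosing /=; apply: le_trans.
by rewrite ler_wpM2r// mdist_ge0.
Qed.

Lemma theta_rate_ge (tbar deltabar xilow elow : R) x y :
  0 < xilow -> 0 < elow -> t y <= tbar -> delta x <= deltabar ->
  xilow <= xi x -> elow <= e x y ->
  (xilow * elow) / (tbar * deltabar) <= theta_rate t delta xi e x y.
Proof.
move=> xilow_gt0 elow_gt0 t_le delta_le xi_ge e_ge.
have tbar_gt0 : 0 < tbar := lt_le_trans (t_gt0 y) t_le.
have deltabar_gt0 : 0 < deltabar := lt_le_trans (delta_gt0 x) delta_le.
apply: ler_pM; first by rewrite ltW// mulr_gt0.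
- by rewrite invr_ge0 ltW// mulr_gt0.
- by rewrite ler_pM// ltW.
- by rewrite lef_pV2 ?posrE ?mulr_gt0// ler_pM// ltW.
Qed.

End Worthwhile.

Section Enclosing.
Import metricType_numDomainType.
Variables (R : realType) (X : metricType R) (theta : R) (g : X -> R).
Hypothesis theta_gt0 : 0 < theta.

Local Notation S := (enclosing theta g).

Lemma enclosing_refl x : S x x.
Proof. by rewrite /enclosing /= mdistxx mulr0 subrr. Qed.

Lemma enclosing_trans x y : S x y -> S y `<=` S x.
Proof.
rewrite /enclosing => /= xy z /= yz.
have : theta * mdist x z <= theta * (mdist x y + mdist y z).
  by rewrite ler_pM2l// metric_triangle.
by rewrite mulrDr; lra.
Qed.

Lemma enclosing_mono x y : S x y -> g x <= g y.
Proof.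
rewrite /enclosing /= => xy; rewrite -subr_ge0; apply: le_trans xy.
by rewrite mulr_ge0 ?mdist_ge0 // ltW.
Qed.

(** S(x) is a superlevel set of y |-> g y - theta d(x,y), which is upper
    semicontinuous as the sum of g and a continuous function. *)
Lemma closed_enclosing x : upper_semicontinuous g -> closed (S x).
Proof.
move=> usc y clSy; rewrite /enclosing /=; apply/ler_addgt0Pl => eps eps_gt0.
(* Near y, half of eps covers the excess of g over g y, and the other half the
   variation of theta * d(x,_). *)
have eps2_gt0 : 0 < eps / 2 by rewrite divr_gt0.
have [|V Vy gV] := usc y (- (g y + eps / 2)); first by rewrite lte_fin; lra.
have Bnbhs : nbhs y (ball y (eps / 2 / theta)).
  by apply: nbhsx_ballx; rewrite divr_gt0.
have [z [/= Sxz [/gV + Byz]]] := clSy _ (filterI Vy Bnbhs).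
rewrite lte_fin => gzy.
have dyz : theta * mdist y z < eps / 2.
  by move: Byz; rewrite ballEmdist /= ltr_pdivlMr// mulrC.
have dxy : theta * mdist x y <= theta * (mdist x z + mdist y z).
  by rewrite ler_pM2l// (metric_sym y z) metric_triangle.
move: Sxz dxy; rewrite /enclosing /= mulrDr; lra.
Qed.

Section Process.
Hypothesis g_bounded : has_ubound (range g).

Lemma best_utility_ge x y : S x y -> g y <= best_utility theta g x.
Proof.
move=> Sxy; apply: ub_le_sup; last by exists y.
have [M gM] := g_bounded.
by exists M => _ [z _ <-]; apply: gM; exists z.
Qed.

(** A point at distance d in S(x) improves g by at least theta d, and no point
    of S(x) improves g by more than s(x) - g(x). *)
Lemma enclosing_radius_le x :
  (enclosing_radius theta g x <=
   ((best_utility theta g x - g x) / theta)%:E)%E.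
Proof.
apply: ge_ereal_sup => _ [y Sxy <-].
rewrite lee_fin ler_pdivlMr// mulrC (le_trans Sxy)// lerB//.
exact: best_utility_ge.
Qed.

Variable u : nat -> X.
Hypothesis Su : forall n, S (u n) (u n.+1).

Lemma enclosing_chain m n : (m <= n)%N -> S (u m) (u n).
Proof.
elim: n => [|n IHn]; first by rewrite leqn0 => /eqP ->; exact: enclosing_refl.
rewrite leq_eqVlt ltnS => /predU1P[->|/IHn mn]; first exact: enclosing_refl.
exact: enclosing_trans mn _ (Su n).
Qed.

Lemma utility_is_cvg : cvgn (g \o u).
Proof.
apply: nondecreasing_is_cvgn => [m n mn|].
  exact: enclosing_mono (enclosing_chain mn).
by have [M gM] := g_bounded; exists M => _ [n _ <-]; apply: gM; exists (u n).
Qed.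

(** By [enclosing_chain], theta d(u_m,u_n) <= g(u_n) - g(u_m) for m <= n, and
    the convergent sequence g(u_n) is Cauchy. *)
Lemma process_cauchy : cauchy (u @ \oo).
Proof.
apply: cauchy_exP => eps eps_gt0.
have /cauchy_cvgP/cauchyP : cvgn (g \o u) by exact: utility_is_cvg.
(* Two values of g in a ball of this radius differ by less than theta * eps. *)
have e_gt0 : 0 < theta * eps / 2 by rewrite divr_gt0// mulr_gt0.
move=> /(_ _ e_gt0)[l [N _ Nl]]; exists (u N); exists N => // n /= Nn.
rewrite ballEmdist /= -(ltr_pM2l theta_gt0).
apply: le_lt_trans (enclosing_chain Nn) _.
have := Nl _ (leqnn N); have := Nl _ Nn; rewrite /ball /= !ltr_distl.
by move=> /andP[? ?] /andP[? ?]; lra.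
Qed.

(** The gains g(u_{i+1}) - g(u_i) telescope, so the partial sums of
    theta d(u_i,u_{i+1}) stay below M - g(u_0), where M bounds g. *)
Lemma process_length_lty :
  (\sum_(0 <= n <oo) (mdist (u n) (u n.+1))%:E < +oo)%E.
Proof.
have [M gM] := g_bounded.
apply: (@le_lt_trans _ _ ((M - g (u 0%N)) / theta)%:E); last exact: ltry.
apply: lime_le.
  by apply: is_cvg_nneseries => n _ _; rewrite lee_fin mdist_ge0.
apply: nearW => n; rewrite sumEFin lee_fin ler_pdivlMr// mulr_suml.
apply: (@le_trans _ _ (\sum_(0 <= i < n) (g (u i.+1) - g (u i)))).
  by apply: ler_sum => i _; rewrite mulrC; exact: Su.
by rewrite telescope_sumr// lerB//; apply: gM; exists (u n).
Qed.

(** The improvement condition bounds the radius of S(u_n) by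
    (g(u_{n+1}) - g(u_n)) / (sigma theta), a multiple of the increment of a
    convergent sequence. *)
Lemma enclosing_radius_cvg0 (sigma : R) : 0 < sigma ->
  (forall n, sigma * (best_utility theta g (u n) - g (u n))
             <= g (u n.+1) - g (u n)) ->
  enclosing_radius theta g (u n) @[n --> \oo] --> 0%E.
Proof.
move=> sigma_gt0 improve.
pose b n := (g (u n.+1) - g (u n)) / sigma / theta.
apply: (@squeeze_cvge _ _ _ _ (cst 0%E) _ (fun n => (b n)%:E)).
- apply: nearW => n; apply/andP; split.
    by apply: ereal_sup_ubound; exists (u n);
      [exact: enclosing_refl|rewrite mdistxx].
  apply: (le_trans (enclosing_radius_le _)).
  by rewrite lee_fin ler_pM2r ?invr_gt0// ler_pdivlMr// mulrC.
- exact: cvg_cst.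
- apply: cvg_EFin; first exact: nearW.
  have -> : 0 = (limn (g \o u) - limn (g \o u)) / sigma / theta :> R.
    by rewrite subrr !mul0r.
  apply: cvgMr_tmp; apply: cvgMr_tmp; apply: cvgB.
    by rewrite (@cvg_shiftS R (g \o u)); exact: utility_is_cvg.
  exact: utility_is_cvg.
Qed.

(** All terms from u_n on lie in S(u_n), which is closed. *)
Lemma limit_in_enclosing x : upper_semicontinuous g ->
  u n @[n --> \oo] --> x -> forall n, S (u n) x.
Proof.
move=> usc ux n.
apply: (@closed_cvg _ _ _ _ _ (S (u n)) (@closed_enclosing _ usc) _ _ ux).
by exists n => // m /= nm; exact: enclosing_chain.
Qed.

(** A point y of S(x) lies in every S(u_n) by transitivity, so d(u_n,y) is at
    most the radius of S(u_n): the process converges to y as well as to x, and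
    limits are unique. *)
Lemma enclosing_limit x : upper_semicontinuous g ->
  u n @[n --> \oo] --> x ->
  enclosing_radius theta g (u n) @[n --> \oo] --> 0%E ->
  S x = [set x].
Proof.
move=> usc ux r0; apply/seteqP; split=> [y Sxy|_ ->]; last exact: enclosing_refl.
apply/esym; apply: (cvg_unique (@metric_hausdorff _ X) ux).
apply/cvgrPdist_lt => eps eps_gt0.
have : \forall n \near \oo, (enclosing_radius theta g (u n) < eps%:E)%E.
  exact: r0 (nbhs_open_ereal_lt (f := fun=> eps) eps_gt0).
apply: filterS => n rn; rewrite metric_sym -lte_fin.
apply: le_lt_trans rn; apply: ereal_sup_ubound; exists y => //.
exact: enclosing_trans (limit_in_enclosing usc ux n) _ Sxy.
Qed.

End Process.
End Enclosing.

Lemma nneseries_scale_lty (R : realType) (c : R) (a b : nat -> R) : 0 < c ->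
  (forall n, 0 <= a n) -> (forall n, c * a n <= b n) ->
  (\sum_(0 <= n <oo) (b n)%:E < +oo -> \sum_(0 <= n <oo) (a n)%:E < +oo)%E.
Proof.
move=> c_gt0 a_ge0 cab sumb.
have b_ge0 n : 0 <= b n by apply: le_trans (cab n); rewrite mulr_ge0// ltW.
apply: (@le_lt_trans _ _ (\sum_(0 <= n <oo) (c^-1)%:E * (b n)%:E)%E).
  apply: lee_nneseries => [n _ _|n _]; first by rewrite lee_fin.
  by rewrite -EFinM lee_fin ler_pdivlMl.
rewrite nneseriesZl => [|n _]; last by rewrite lee_fin.
by apply: lte_mul_pinfty => //; rewrite lee_fin invr_ge0 ltW.
Qed.

(* The lower bound on alpha along the process in the finite-time claim is not in
   the source: without it the sum of the t (u n) does not control the sum of the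
   h (u n) = t (u n) / alpha (u n), and the claim fails. *)
Theorem mainTheorem4 (R : realType) (X : metricType R)
    (g t delta xi : X -> R) (e : X -> X -> R)
    (tbar deltabar xilow elow : R)
    (h alpha : X -> R) (tmove : X -> X -> R) (p : X -> R)
    (g_bounded : has_ubound (range g))
    (tbar_gt0 : 0 < tbar) (deltabar_gt0 : 0 < deltabar)
    (xilow_gt0 : 0 < xilow) (elow_gt0 : 0 < elow)
    (t_bounds : forall y, 0 < t y <= tbar)
    (delta_bounds : forall x, 0 < delta x <= deltabar)
    (xi_gt0 : forall x, 0 < xi x) (xi_bound : forall x, xi x >= xilow)
    (e_gt0 : forall x y, 0 < e x y) (e_bound : forall x y, e x y >= elow)
    (h_ge0 : forall x, 0 <= h x) (alpha_01 : forall x, 0 <= alpha x <= 1)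
    (t_alpha_h : forall x, t x = alpha x * h x)
    (tmove_ge0 : forall x y, 0 <= tmove x y) (tmovexx : forall x, tmove x x = 0)
    (p_gt0 : forall x, 0 < p x) :
  let theta := (xilow * elow) / (tbar * deltabar) in
  let W := worthwhile g t delta xi e in
  let S := enclosing theta g in
  let s := best_utility theta g in
  (0 < theta /\ forall x y, theta_rate t delta xi e x y >= theta) /\
  (* (a) *)
  ((forall x, W x `<=` S x) /\ (forall x y, S x y -> S y `<=` S x)) /\
  (* (b) *)
  (complete_space X ->
   forall u : nat -> X, (forall n, W (u n) (u n.+1)) ->
     (forall n, S (u n) (u n.+1)) /\
     (exists xstar : X, u n @[n --> \oo] --> xstar) /\
     ((\sum_(0 <= n <oo) (t (u n))%:E < +oo)%E ->
      (exists2 v : R, 0 < v &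
         forall n, mdist (u n) (u n.+1) >= v * tmove (u n) (u n.+1)) ->
      (exists2 a : R, 0 < a & forall n, alpha (u n) >= a) ->
      (\sum_(0 <= n <oo) (h (u n) + tmove (u n) (u n.+1))%:E < +oo)%E)) /\
  (* (c) *)
  (complete_space X ->
   forall u : nat -> X, (forall n, W (u n) (u n.+1)) ->
   forall sigma : R, 0 < sigma < 1 ->
     (forall n, g (u n.+1) - g (u n) >= sigma * (s (u n) - g (u n))) ->
     exists xstar : X,
       u n @[n --> \oo] --> xstar /\
       enclosing_radius theta g (u n) @[n --> \oo] --> 0%E /\
       (upper_semicontinuous g ->
          S xstar = [set xstar] /\
          W xstar = [set xstar] /\
          aspiration theta g p xstar = g xstar)).
Proof.
move=> theta W S s.
have t_gt0 y : 0 < t y by have /andP[] := t_bounds y.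
have delta_gt0 x : 0 < delta x by have /andP[] := delta_bounds x.
have theta_gt0 : 0 < theta by rewrite divr_gt0// mulr_gt0.
have theta_le x y : theta <= theta_rate t delta xi e x y.
  have /andP[_ ty] := t_bounds y; have /andP[_ dx] := delta_bounds x.
  exact: theta_rate_ge.
have WS x : W x `<=` S x by apply: worthwhile_sub_enclosing.
split=> //; split; first by split=> // x y; exact: enclosing_trans.
split=> cX u Wu; have Su n : S (u n) (u n.+1) by exact: WS.
- split=> //; split.
    by apply: cX; exact: process_cauchy theta_gt0 g_bounded u Su.
  move=> sum_t [v v_gt0 speed] [a a_gt0 alpha_ge].
  under eq_eseriesr do rewrite EFinD.
  rewrite nneseriesD => [|n _ _|n _ _]; rewrite ?lee_fin//.
  apply: lte_add_pinfty.
    apply: (nneseries_scale_lty a_gt0 _ _ sum_t) => n //.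
    by rewrite t_alpha_h ler_wpM2r.
  apply: (nneseries_scale_lty v_gt0 _ speed) => [n //|].
  exact: process_length_lty theta_gt0 g_bounded u Su.
- move=> sigma /andP[sigma_gt0 _] improve.
  have [x ux] : exists x : X, u n @[n --> \oo] --> x.
    by apply: cX; exact: process_cauchy theta_gt0 g_bounded u Su.
  have radius0 := enclosing_radius_cvg0 theta_gt0 g_bounded Su sigma_gt0 improve.
  exists x; split=> //; split=> // usc.
  have Sx : S x = [set x] := enclosing_limit theta_gt0 Su usc ux radius0.
  split=> //; split.
    apply/seteqP; split=> [y /WS|_ ->]; first by rewrite Sx.
    exact: worthwhile_refl.
  rewrite /aspiration /best_utility -/S Sx image_set1 sup1.
  by rewrite subrr mulr0 addr0.
Qed.
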